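(* Let $d\ge 1$ be an integer, and for $\mathbf{x},\mathbf{y}\in\mathbb{R}^d$ let $c(\mathbf{x},\mathbf{y}):=\sum_{i=1}^d (x_i-y_i)_+$ and $g(\mathbf{x}):=\sum_{i=1}^d x_i$. Let $\gamma\in[0,1]$ and let $\mathbf{X},\mathbf{Y}$ be $\mathbb{R}^d$-valued random vectors with $\mathbb{E}[\sum_{i=1}^d|X_i|]<\infty$ and $\mathbb{E}[\sum_{i=1}^d|Y_i|]<\infty$, satisfying $\mathbb{E}[g(\mathbf{X})]\le\mathbb{E}[g(\mathbf{Y})]$. Then $$\gamma^\ast(\mathbf{X},\mathbf{Y};g)\le\gamma\quad\Longleftrightarrow\quad \mathbf{X}\le_\gamma\mathbf{Y}.$$
   Context: Here $x_+:=\max(x,0)$ for $x\in\mathbb{R}$. For $\mathbb{R}^d$-valued random vectors, $\mathrm{OT}_c(\mathbf{X},\mathbf{Y}):=\inf \mathbb{E}[c(\tilde{\mathbf{X}},\tilde{\mathbf{Y}})]$, where the infimum is over all couplings, i.e. all pairs $(\tilde{\mathbf{X}},\tilde{\mathbf{Y}})$ with $\tilde{\mathbf{X}}\overset{d}{=}\mathbf{X}$ and $\tilde{\mathbf{Y}}\overset{d}{=}\mathbf{Y}$ (equality in law). When $\mathbb{E}[g(\mathbf{X})]\le\mathbb{E}[g(\mathbf{Y})]$, $$\gamma^\ast(\mathbf{X},\mathbf{Y};g):=\frac{\mathrm{OT}_c(\mathbf{X},\mathbf{Y})}{\mathbb{E}[g(\mathbf{Y})]-\mathbb{E}[g(\mathbf{X})]+\mathrm{OT}_c(\mathbf{X},\mathbf{Y})},\qquad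 0/0:=0.$$ For $\gamma\in[0,1]$, $\mathcal{U}_\gamma$ is the class of continuously differentiable functions $u:\mathbb{R}^d\to\mathbb{R}$ with $\gamma\le\frac{\partial u}{\partial x_i}(\mathbf{x})\le 1$ for all $\mathbf{x}\in\mathbb{R}^d$ and all $i\in\{1,\dots,d\}$. One writes $\mathbf{X}\le_\gamma\mathbf{Y}$ ($\gamma$-almost stochastic dominance) if $\mathbb{E}[u(\mathbf{X})]\le\mathbb{E}[u(\mathbf{Y})]$ for all $u\in\mathcal{U}_\gamma$. *)

(* Defs.v *)
From HB Require Import structures.
From mathcomp Require Import all_boot all_order all_algebra.
From mathcomp Require Import all_classical all_reals all_analysis.

Set Implicit Arguments.
Unset Strict Implicit.
Unset Printing Implicit Defensive.

Import Order.TTheory GRing.Theory Num.Theory.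
Import numFieldNormedType.Exports.

Local Open Scope classical_set_scope.
Local Open Scope ring_scope.

(* R^d with its Borel sigma-algebra. It is convertible to 'rV[R]_d, which
   carries the topology and the norm but no canonical sigma-algebra. *)
Notation borel_rV R d := (g_sigma_algebraType (@open 'rV[R]_d)).

Section costs.
Context {R : realType} {d : nat}.
Implicit Types x y : 'rV[R]_d.

Definition cost x y : R := \sum_(i < d) Num.max (x ord0 i - y ord0 i) 0.

Definition coord_sum x : R := \sum_(i < d) x ord0 i.

Definition norm1 x : R := \sum_(i < d) `|x ord0 i|.

End costs.

Definition eq_in_law (R : realType) d1 d2 d'
    (T1 : measurableType d1) (T2 : measurableType d2) (T' : measurableType d')
    (P : probability T1 R) (Q : probability T2 R)
    (X : {RV P >-> T'}) (Y : {RV Q >-> T'}) : Prop :=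
  forall A : set T', measurable A -> distribution P X A = distribution Q Y A.

Section transport.
Context {R : realType} {d : nat} {d1 d2 : measure_display}.
Context {T1 : measurableType d1} {T2 : measurableType d2}.
Context {P : probability T1 R} {Q : probability T2 R}.
Variables (c : 'rV[R]_d -> 'rV[R]_d -> R) (g : 'rV[R]_d -> R).
Variables (X : {RV P >-> borel_rV R d}) (Y : {RV Q >-> borel_rV R d}).

Local Open Scope ereal_scope.

(* A coupling may live on any probability space, not only on those of X, Y. *)
Definition coupling_costs : set (\bar R) :=
  [set e | exists (d0 : measure_display) (T : measurableType d0)
      (S : probability T R) (X' Y' : {RV S >-> borel_rV R d}),
    [/\ eq_in_law X' X, eq_in_law Y' Y &
        e = 'E_S[fun w => c (X' w) (Y' w)]]].

Definition OT : \bar R := ereal_inf coupling_costs.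

(* [fine] maps infinite values to 0; for integrable X and Y, c = cost and
   g = coord_sum, all three extended reals below are finite. The convention
   0/0 := 0 is that of the division of R. *)
Definition gamma_star : R :=
  (fine OT / (fine 'E_Q[g \o Y] - fine 'E_P[g \o X] + fine OT))%R.

End transport.

Definition continuously_differentiable (R : realType) (d : nat)
    (u : 'rV[R]_d -> R) : Prop :=
  (forall x, differentiable u x) /\
  (forall i : 'I_d, continuous (fun x => 'D_(delta_mx ord0 i) u x)).

(* The derivative along the i-th basis vector is the i-th partial derivative. *)
Definition utility_class (R : realType) (d : nat) (gamma : R) :
    set ('rV[R]_d -> R) :=
  [set u | continuously_differentiable u /\
    forall (x : 'rV[R]_d) (i : 'I_d),
      gamma <= 'D_(delta_mx ord0 i) u x <= 1].

Definition almost_dominated (R : realType) (d : nat) (gamma : R) d1 d2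
    (T1 : measurableType d1) (T2 : measurableType d2)
    (P : probability T1 R) (Q : probability T2 R)
    (X : {RV P >-> borel_rV R d}) (Y : {RV Q >-> borel_rV R d}) : Prop :=
  forall u, utility_class gamma u -> ('E_P[u \o X] <= 'E_Q[u \o Y])%E.

(* Main.v *)
(* Both sides are equivalent to (1 - gamma) OT <= gamma m, where m is the
   difference E[g(Y)] - E[g(X)]. If this inequality holds, dominance follows by
   integrating over couplings the mean value estimate
     u(x) - u(y) <= gamma (g(x) - g(y)) + (1 - gamma) c(x, y),  u in U_gamma.
   Conversely gamma g + (1 - gamma) v is in U_gamma for every v in U_0, so it
   suffices to approximate OT by E[v(X)] - E[v(Y)] with v in U_0. Replacing X
   and Y by L^1-close vectors with finitely many values reduces this to finite
   transport duality, i.e. Farkas' lemma. Optimal potentials extend to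
   min_j (c(x, y_j) - psi_j), which is made C^1 by replacing minimum and
   positive part by their log-sum-exp versions; a plan between the discretized
   laws lifts to a coupling of X and Y by rescaling the product measure on each
   product of cells, so no disintegration or compactness is needed. *)

Require Import Defs.
From HB Require Import structures.
From mathcomp Require Import all_boot all_order all_algebra.
From mathcomp Require Import all_classical all_reals all_analysis.
From mathcomp Require Import measurable_realfun ring lra.

Set Implicit Arguments.
Unset Strict Implicit.
Unset Printing Implicit Defensive.

Import Order.TTheory GRing.Theory Num.Theory.
Import numFieldNormedType.Exports.
Import HBSimple.

Local Open Scope classical_set_scope.
Local Open Scope ring_scope.

(** * Farkas' lemma and finite transport duality *)

(** By induction on the number of generators. If [b] is outside the cone of all generators but [v],
    some [y] separates it. Either [y] is also nonnegative on [v], or everything is projected along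
    [v] and the induction hypothesis is used a second time. *)
Lemma farkas_ord (F : realFieldType) (I : finType) (n : nat)
    (a : 'I_n -> I -> F) (b : I -> F) :
  (exists2 l : 'I_n -> F, (forall k, 0 <= l k) &
    forall i, b i = \sum_k l k * a k i) \/
  (exists2 y : I -> F, (forall k, 0 <= \sum_i y i * a k i) &
    \sum_i y i * b i < 0).
Proof.
elim: n a b => [|n IHn] a b.
  have [b0|/eqP b0] := eqVneq (\sum_i b i * b i) 0.
    left; exists (fun=> 0) => // i; rewrite big_ord0.
    have /eqP : b i * b i = 0.
      by apply: (psumr_eq0P _ b0) => // j _; rewrite -expr2 sqr_ge0.
    by rewrite mulf_eq0 orbb => /eqP.
  right; exists (fun i => - b i) => [[]//|].
  under eq_bigr do rewrite mulNr.
  rewrite sumrN oppr_lt0 lt_neqAle sumr_ge0 ?andbT => [|i _].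
    by rewrite eq_sym; apply/eqP.
  by rewrite -expr2 sqr_ge0.
pose dot (y z : I -> F) := \sum_i y i * z i.
have dotBZ y z w s : dot y (fun i => z i - s * w i) = dot y z - s * dot y w.
  rewrite /dot mulr_sumr -sumrB; apply: eq_bigr => i _; ring.
have dotBZl y z w s : dot (fun i => z i - s * w i) y = dot z y - s * dot w y.
  rewrite /dot mulr_sumr -sumrB; apply: eq_bigr => i _; ring.
have [[l l0 bl]|[y ya yb]] := IHn (fun k => a (lift ord0 k)) b.
  left; exists (fun k => if unlift ord0 k is Some j then l j else 0) => [k|i].
    by case: unliftP.
  rewrite big_ord_recl unlift_none mul0r add0r bl.
  by apply: eq_bigr => k _; rewrite liftK.
set v := a ord0.
have [yv|yv] := lerP 0 (dot y v).
  right; exists y => // k; case: (unliftP ord0 k) => [j ->|->]//.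
(* Eliminate [v]: project everything onto the hyperplane orthogonal to [y]
   along [v]. *)
pose pr (z : I -> F) i := z i - dot y z / dot y v * v i.
have [[l l0 bl]|[z za zb]] := IHn (fun k => pr (a (lift ord0 k))) (pr b).
  (* The coefficient of [v] is nonnegative: [dot y b] and [dot y v] are negative, while [y] is
     nonnegative on the other generators. *)
  left; exists (fun k => if unlift ord0 k is Some j then l j else
      dot y b / dot y v - \sum_j l j * (dot y (a (lift ord0 j)) / dot y v)).
    move=> k; case: unliftP => // _.
    rewrite subr_ge0 (@le_trans _ _ 0)//.
      apply: sumr_le0 => j _; rewrite mulr_ge0_le0// mulr_ge0_le0 ?ya//.
      by rewrite invr_le0 ltW.
    by rewrite mulr_le0 ?invr_le0 ?ltW.
  move=> i; rewrite big_ord_recl unlift_none.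
  have -> : b i = pr b i + dot y b / dot y v * v i by rewrite /pr subrK.
  rewrite bl -/v; under [X in _ = _ + X]eq_bigr do rewrite liftK.
  have -> : \sum_k l k * pr (a (lift ord0 k)) i = \sum_k l k * a (lift ord0 k) i
      - (\sum_k l k * (dot y (a (lift ord0 k)) / dot y v)) * v i.
    by rewrite mulr_suml -sumrB; apply: eq_bigr => j _; rewrite /pr; ring.
  ring.
(* This vector is orthogonal to [v] and pairs with any [w] as [z] pairs with [pr w]. *)
right; exists (fun i => z i - dot z v / dot y v * y i).
  move=> k; rewrite -/(dot _ _) dotBZl.
  case: (unliftP ord0 k) => [j ->|->].
    have := za j; rewrite -/(dot _ _) dotBZ => /le_trans; apply.
    by rewrite le_eqVlt; apply/orP; left; apply/eqP; ring.
  by rewrite -/v divfK ?lt_eqF// subrr.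
move: zb; rewrite -!/(dot _ _) dotBZ dotBZl; congr (_ < _); ring.
Qed.

Lemma farkas (F : realFieldType) (I K : finType)
    (a : K -> I -> F) (b : I -> F) :
  (exists2 l : K -> F, (forall k, 0 <= l k) &
    forall i, b i = \sum_k l k * a k i) \/
  (exists2 y : I -> F, (forall k, 0 <= \sum_i y i * a k i) &
    \sum_i y i * b i < 0).
Proof.
have [[l l0 bl]|[y ya yb]] := farkas_ord (fun k : 'I_#|K| => a (enum_val k)) b.
  left; exists (fun k => l (enum_rank k)) => // i.
  rewrite bl (reindex_onto enum_rank enum_val) => [|k _]; last exact: enum_valK.
  by apply: eq_big => k; rewrite ?enum_rankK ?eqxx.
by right; exists y => // k; rewrite -(enum_rankK k).
Qed.

(** Farkas' lemma for the system formed by the marginal constraints and the cost bound. A separating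
    vector has a positive cost coordinate [s], and dividing its marginal coordinates by [- s] gives
    the potentials. *)
Lemma transport_duality (F : realFieldType) (A B : finType)
    (p : A -> F) (q : B -> F) (c : A -> B -> F) (t : F) :
  (forall i, 0 <= p i) -> (forall j, 0 <= q j) ->
  \sum_i p i = 1 -> \sum_j q j = 1 ->
  (exists pi : A -> B -> F, [/\ forall i j, 0 <= pi i j,
     forall i, \sum_j pi i j = p i, forall j, \sum_i pi i j = q j &
     \sum_i \sum_j c i j * pi i j <= t]) \/
  (exists phi psi, (forall i j, phi i + psi j <= c i j) /\
     t < \sum_i p i * phi i + \sum_j q j * psi j).
Proof.
move=> p0 q0 p1 q1.
(* The last generator is a slack variable. *)
pose a (k : (A * B) + 'I_1) (s : (A + B) + 'I_1) : F :=
  match k, s with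
  | inl (i, j), inl (inl i') => (i == i')%:R
  | inl (i, j), inl (inr j') => (j == j')%:R
  | inl (i, j), inr _ => c i j
  | inr _, inl _ => 0
  | inr _, inr _ => 1
  end.
pose b (s : (A + B) + 'I_1) : F :=
  match s with inl (inl i) => p i | inl (inr j) => q j | inr _ => t end.
have [[l l0 bl]|[y ya yb]] := farkas a b.
  left; exists (fun i j => l (inl (i, j))); split => // [i|j|].
  - have /= -> := bl (inl (inl i)).
    rewrite big_sumType/= big_ord1 mulr0 addr0.
    transitivity (\sum_i' \sum_j l (inl (i', j)) * (i' == i)%:R); last first.
      by rewrite pair_bigA/=; apply: eq_bigr => -[].
    rewrite (bigD1 i)//= [X in _ = _ + X]big1 ?addr0 => [|i' /negPf ->].
      by apply: eq_bigr => j _; rewrite eqxx mulr1.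
    by rewrite big1// => j _; rewrite mulr0.
  - have /= -> := bl (inl (inr j)).
    rewrite big_sumType/= big_ord1 mulr0 addr0.
    transitivity (\sum_i \sum_j' l (inl (i, j')) * (j' == j)%:R); last first.
      by rewrite pair_bigA/=; apply: eq_bigr => -[].
    apply: eq_bigr => i _; rewrite (bigD1 j)//= eqxx mulr1 big1 ?addr0//.
    by move=> j' /negPf ->; rewrite mulr0.
  - have /= -> := bl (inr ord0).
    rewrite big_sumType/= big_ord1 mulr1 -[leLHS]addr0 lerD//.
    rewrite pair_bigA/= le_eqVlt; apply/orP; left; apply/eqP.
    by apply: eq_bigr => -[i j] _; rewrite mulrC.
right; pose s := y (inr ord0).
have s0 : 0 <= s.
  have := ya (inr ord0); rewrite big_sumType/= big_ord1 mulr1 big1 ?add0r//.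
  by move=> i _; rewrite mulr0.
pose al i := y (inl (inl i)); pose be j := y (inl (inr j)).
have yc i j : 0 <= al i + be j + s * c i j.
  have := ya (inl (i, j)); rewrite big_sumType/= big_ord1 big_sumType/=.
  rewrite (bigD1 i)//= eqxx mulr1 big1 ?addr0 => [|i' ]; last first.
    by rewrite eq_sym => /negPf ->; rewrite mulr0.
  rewrite (bigD1 j)//= eqxx mulr1 big1 ?addr0 => [//|j' ].
  by rewrite eq_sym => /negPf ->; rewrite mulr0.
have {}yb : \sum_i al i * p i + \sum_j be j * q j + s * t < 0.
  by move: yb; rewrite big_sumType/= big_ord1 big_sumType.
(* Since both masses are 1, the marginal part averages [al i + be j] over the product plan. If [s]
   were 0, it would be nonnegative by [yc], contradicting [yb]. *)
have dbl : \sum_i al i * p i + \sum_j be j * q j =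
    \sum_i \sum_j p i * q j * (al i + be j).
  transitivity (\sum_i (al i * p i * \sum_j q j + p i * \sum_j be j * q j)).
    rewrite big_split/= q1 -[X in _ = _ + X]mulr_suml p1 mul1r; congr (_ + _).
    by under [RHS]eq_bigr do rewrite mulr1.
  apply: eq_bigr => i _; rewrite !mulr_sumr -big_split/=.
  by apply: eq_bigr => j _; ring.
have {s0}sp : 0 < s.
  rewrite lt_neqAle s0 andbT; apply/eqP => s_0.
  move: yb; rewrite -s_0 mul0r addr0 dbl ltNge => /negP; apply.
  apply: sumr_ge0 => i _; apply: sumr_ge0 => j _; rewrite mulr_ge0 ?mulr_ge0//.
  by have := yc i j; rewrite -s_0 mul0r addr0.
exists (fun i => - al i / s), (fun j => - be j / s); split => [i j|].
  rewrite -mulrDl ler_pdivrMr// mulrC; have := yc i j; lra.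
rewrite -(ltr_pM2l sp) mulrDr.
have -> : s * \sum_i p i * (- al i / s) = - \sum_i al i * p i.
  by rewrite mulr_sumr -sumrN; apply: eq_bigr => i _; field; rewrite gt_eqF.
have -> : s * \sum_j q j * (- be j / s) = - \sum_j be j * q j.
  by rewrite mulr_sumr -sumrN; apply: eq_bigr => i _; field; rewrite gt_eqF.
by move: yb; lra.
Qed.

(** * Utilities *)

(** Carries an explicit gradient along with differentiability, so that partial derivatives of
    composite functions are computed by rules instead of limits. *)
Definition has_grad (R : realType) (d : nat) (u : 'rV[R]_d -> R)
    (du : 'I_d -> 'rV[R]_d -> R) :=
  forall x, differentiable u x /\ forall i,
    'D_(delta_mx ord0 i) u x = du i x /\ {for x, continuous (du i)}.

Section gradients.
Context {R : realType} {d : nat}.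
Implicit Types (u : 'rV[R]_d -> R) (du : 'I_d -> 'rV[R]_d -> R).

Lemma has_grad_C1 u du : has_grad u du -> continuously_differentiable u.
Proof.
move=> h; split => [x|i]; first by have [] := h x.
have -> : (fun x => 'D_(delta_mx ord0 i) u x) = du i.
  by apply/funext => x; have [_ /(_ i)[]] := h x.
by move=> x; have [_ /(_ i)[]] := h x.
Qed.

Lemma has_grad_eq u du du' : has_grad u du ->
  (forall i x, du i x = du' i x) -> has_grad u du'.
Proof.
move=> h e; suff <- : du = du' by [].
by apply/funext => i; apply/funext => x.
Qed.

Lemma has_grad_cst (k : R) : has_grad (fun _ : 'rV[R]_d => k) (fun=> fun=> 0).
Proof.
move=> x; split; first exact: differentiable_cst.
move=> i; split; first exact: derive_cst.
exact: cst_continuous.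
Qed.

Lemma has_grad_coord k :
  has_grad (fun x : 'rV[R]_d => x ord0 k) (fun i _ => (i == k)%:R).
Proof.
move=> x; split; first exact: differentiable_coord.
move=> i; split; last exact: cst_continuous.
(* For nonzero increments the difference quotient is constant. *)
rewrite /derive; apply: cvg_lim => //; apply: cvg_near_cst.
near=> h.
have h0 : h != 0 by near: h; exact: nbhs_dnbhs_neq.
by rewrite /= !mxE eqxx/= addrK [_ *: _]mulrA mulVf// mul1r eq_sym.
Unshelve. all: by end_near. Qed.

Lemma has_gradD u v du dv : has_grad u du -> has_grad v dv ->
  has_grad (fun x => u x + v x) (fun i x => du i x + dv i x).
Proof.
move=> hu hv x; have [du1 du2] := hu x; have [dv1 dv2] := hv x.
split; first exact: differentiableD.
move=> i; have [du3 du4] := du2 i; have [dv3 dv4] := dv2 i; split.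
  by rewrite deriveD ?du3 ?dv3//; exact: diff_derivable.
exact: (continuousD du4 dv4).
Qed.

Lemma has_grad_sum (I : finType) (u : I -> 'rV[R]_d -> R)
    (du : I -> 'I_d -> 'rV[R]_d -> R) :
  (forall j, has_grad (u j) (du j)) ->
  has_grad (fun x => \sum_j u j x) (fun i x => \sum_j du j i x).
Proof.
move=> h; rewrite /index_enum; elim: (Finite.enum _) => [|j s IHs].
  under [X in has_grad X _]eq_fun do rewrite big_nil.
  apply: has_grad_eq (has_grad_cst 0) _ => i x; by rewrite big_nil.
under [X in has_grad X _]eq_fun do rewrite big_cons.
apply: has_grad_eq (has_gradD (h j) IHs) _ => i x; by rewrite big_cons.
Qed.

Lemma has_grad_comp (g : R -> R) (dg : R -> R) u du : has_grad u du ->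
  (forall x, is_derive (u x) (1 : R) g (dg (u x))) ->
  (forall x, {for u x, continuous dg}) ->
  has_grad (fun x => g (u x)) (fun i x => dg (u x) * du i x).
Proof.
move=> hu hg cg x; have [du1 du2] := hu x.
have dgx : differentiable g (u x) by apply/derivable1_diffP; apply: ex_derive.
split; first exact: differentiable_comp.
move=> i; have [du3 du4] := du2 i; split.
  rewrite deriveE; last exact: differentiable_comp.
  rewrite diff_comp//= -(deriveE _ du1) du3.
  rewrite deriv1E; last exact/derivable1_diffP.
  by rewrite derive1E derive_val mulrC.
have cdgu : {for x, continuous (dg \o u)}.
  by apply: continuous_comp; [exact: differentiable_continuous|exact: cg].
exact: (continuousM cdgu du4).
Qed.

Lemma has_gradZ k u du : has_grad u du ->
  has_grad (fun x => k * u x) (fun i x => k * du i x).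
Proof.
move=> hu; apply: (has_grad_comp (g := *%R k) (dg := fun=> k) hu) => x.
  have := is_deriveZ k (is_derive_id (u x) (1 : R)).
  by rewrite [k *: 1]mulr1.
exact: cst_continuous.
Qed.

Lemma has_grad_exp u du : has_grad u du ->
  has_grad (fun x => expR (u x)) (fun i x => expR (u x) * du i x).
Proof. by move=> hu; apply: has_grad_comp => // x; exact: continuous_expR. Qed.

Lemma has_grad_ln u du : has_grad u du -> (forall x, 0 < u x) ->
  has_grad (fun x => ln (u x)) (fun i x => (u x)^-1 * du i x).
Proof.
move=> hu u0; apply: (has_grad_comp (g := @ln R) (dg := GRing.inv)) => // x.
  exact: is_derive1_ln.
by apply: inv_continuous; rewrite gt_eqF.
Qed.

End gradients.

(* [e ln (1 + exp (t / e))] is a smooth substitute for [max t 0], and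
   [- e ln (\sum_j exp (- t_j / e))] for [min_j t_j]. *)
Lemma smooth_potential (R : realType) (d : nat) (A B : finType)
    (x : A -> 'rV[R]_d) (y : B -> 'rV[R]_d) (phi : A -> R) (psi : B -> R)
    (delta : R) :
  0 < delta -> (0 < #|B|)%N ->
  (forall i j, phi i + psi j <= cost (x i) (y j)) ->
  exists u, [/\ utility_class 0 u, forall i, phi i - delta <= u (x i) &
    forall j, u (y j) <= delta - psi j].
Proof.
move=> delta0 B0 phipsi.
(* The errors below are [e * ln #|B|] and [d * e * ln 2]; this [e] keeps both at most [delta]. *)
pose e := delta / (d + #|B|)%:R.
have n0 : 0 < (d + #|B|)%:R :> R by rewrite ltr0n addn_gt0 B0 orbT.
have e0 : 0 < e by rewrite divr_gt0.
have den0 t : 0 < 1 + expR t :> R by rewrite addr_gt0 ?expR_gt0.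
(* [sp] softens the positive part, [sg] is its derivative, the logistic function, and [C j] softens
   [cost _ (y j)]. *)
pose sp t := e * ln (1 + expR (e^-1 * t)).
pose sg (t : R) := (1 + expR (e^-1 * t))^-1 * expR (e^-1 * t).
pose C j (z : 'rV[R]_d) := \sum_k sp (z ord0 k + - y j ord0 k).
pose E j z := expR (- e^-1 * (C j z + - psi j)).
pose S z := \sum_j E j z.
have S0 z : 0 < S z.
  move/card_gt0P : B0 => [j _]; rewrite /S (bigD1 j)//= ltr_pwDl ?expR_gt0//.
  by apply: sumr_ge0 => k _; exact: expR_ge0.
have gC j : has_grad (C j) (fun i z => sg (z ord0 i + - y j ord0 i)).
  apply: has_grad_eq => [|i z].
    apply: has_grad_sum => k; apply/has_gradZ/has_grad_ln; last by move=> z.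
    apply: has_gradD; first exact: has_grad_cst.
    apply/has_grad_exp/has_gradZ/has_gradD; first exact: has_grad_coord.
    exact: has_grad_cst.
  rewrite /= (bigD1 i)//= big1 => [|k]; last first.
    by rewrite eq_sym => /negPf ->; rewrite !(add0r, mulr0, addr0).
  by rewrite eqxx !(add0r, mulr0, addr0, mulr1) /sg; field; rewrite !gt_eqF.
have gS : has_grad S (fun i z => \sum_j - e^-1 *
    (E j z * sg (z ord0 i + - y j ord0 i))).
  apply: has_grad_eq => [|i z].
    apply: has_grad_sum => j; apply/has_grad_exp/has_gradZ/has_gradD.
      exact: gC.
    exact: has_grad_cst.
  by apply: eq_bigr => j _; rewrite addr0 mulrCA.
have gu := has_gradZ (- e) (has_grad_ln gS S0).
exists (fun z => - e * ln (S z)); split.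
- split; first exact: has_grad_C1 gu.
  (* Each partial derivative is a mean of values of [sg] with weights [E j z / S z], hence lies in
     [0, 1]. *)
  move=> z i; have [_ /(_ i)[-> _]] := gu z.
  rewrite -mulr_sumr mulrCA [- e * _]mulrA mulrNN divff ?gt_eqF// mul1r.
  have sg01 t : 0 <= sg t <= 1.
    rewrite /sg mulr_ge0 ?invr_ge0 ?expR_ge0 ?(ltW (den0 _))//=.
    by rewrite mulrC ler_pdivrMr// mul1r lerDr.
  apply/andP; split.
    rewrite mulr_ge0 ?invr_ge0 ?(ltW (S0 _))// sumr_ge0// => j _.
    by rewrite mulr_ge0 ?expR_ge0//; case/andP: (sg01 (z ord0 i + - y j ord0 i)).
  rewrite mulrC ler_pdivrMr// mul1r ler_sum// => j _.
  by rewrite ler_piMr ?expR_ge0//; case/andP: (sg01 (z ord0 i + - y j ord0 i)).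
(* As [sp] dominates the positive part, each of the [#|B|] summands is at most
   [expR (- e^-1 * phi i)]; the logarithm loses [e * ln #|B|]. *)
- move=> i; have H : S (x i) <= #|B|%:R * expR (- e^-1 * phi i).
    rewrite mulr_natl -sumr_const ler_sum// => j _.
    rewrite ler_expR !mulNr lerN2 ler_pM2l ?invr_gt0// lerBrDr.
    apply: le_trans (phipsi i j) _; apply: ler_sum => k _.
    rewrite ge_max /sp; apply/andP; split; last first.
      by rewrite mulr_ge0 ?(ltW e0)// ln_ge0// lerDl expR_ge0.
    rewrite -ler_pdivrMl// -[leLHS]expRK ler_ln ?posrE ?expR_gt0//.
    by rewrite lerDr.
  have : ln (S (x i)) <= ln #|B|%:R + - e^-1 * phi i.
    rewrite -[X in _ + X]expRK -lnM ?posrE ?expR_gt0 ?ltr0n// ler_ln ?posrE//.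
    by rewrite mulr_gt0 ?expR_gt0 ?ltr0n.
  rewrite -(ler_pM2l e0) mulrDr !mulNr mulrN mulrA divff ?gt_eqF// mul1r.
  have : e * ln #|B|%:R <= delta.
    rewrite /e mulrAC ler_pdivrMr// ler_pM2l//.
    rewrite (le_trans (ltW (ln_sublinear _))) ?ltr0n// ler_nat leq_addl//.
  by lra.
(* The [j]-th summand alone bounds [S (y j)] from below, and [C j (y j)] equals [d * e * ln 2]. *)
- move=> j.
  have : C j (y j) <= delta.
    rewrite /C; under eq_bigr do rewrite subrr /sp mulr0 expR0.
    rewrite sumr_const card_ord -mulr_natr -mulrA /e mulrAC ler_pdivrMr//.
    rewrite ler_pM2l// natrD -[leLHS]mul1r ler_wpDr//.
    rewrite mul1r ler_piMl// le_ln1Dx//; lra.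
  have : - e^-1 * (C j (y j) - psi j) <= ln (S (y j)).
    rewrite -[leLHS]expRK ler_ln ?posrE ?expR_gt0//.
    rewrite /S (bigD1 j)//= lerDl sumr_ge0// => k _; exact: expR_ge0.
  rewrite -(ler_pM2l e0) !mulNr mulrN mulrA divff ?gt_eqF// mul1r.
  by lra.
Qed.

(** * Mean value and Lipschitz estimates for utilities *)

Section utility.
Context {R : realType} {d : nat}.
Implicit Types (u : 'rV[R]_d -> R) (x y : 'rV[R]_d).

(** The one-dimensional mean value theorem on the segment from [y] to [x]. A single [z] serves all
    coordinates because the differential is expanded only afterwards. *)
Lemma utility_mvt u x y : (forall z, differentiable u z) ->
  exists z, u x - u y =
    \sum_i (x ord0 i - y ord0 i) * 'D_(delta_mx ord0 i) u z.
Proof.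
move=> du; pose p (t : R) := y + t *: (x - y).
have dp t : is_diff t p (0 + *:%R^~ (x - y)).
  exact: (is_diffD (is_diff_cst y t) (is_diff_scalel t (x - y))).
have dup t : differentiable (u \o p) t.
  by apply: differentiable_comp => //; exact: ex_diff (dp t).
have [|t _||c _] := @MVT R (u \o p) (fun t => 'd u (p t) (x - y)) 0 1.
- exact: ltr01.
- apply: DeriveDef; first exact/derivable1_diffP.
  rewrite deriveE// diff_comp//.
  by rewrite /= [X in 'd u _ (X _)]diff_val /= add0r scale1r.
- apply: continuous_subspaceT => t; exact: differentiable_continuous.
rewrite /= /p scale1r scale0r addr0 [y + (x - y)]addrC subrK subr0 mulr1 => ->.
exists (p c); rewrite -/(p c) [X in 'd u _ X]row_sum_delta linear_sum.
by apply: eq_bigr => i _; rewrite linearZ/= !mxE deriveE.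
Qed.

(** Coordinatewise, [t * D] is at most [gamma * t] when [t <= 0], by [gamma <= D], and at most [t]
    when [t > 0], by [D <= 1]. *)
Lemma utility_sub_le gamma u x y : utility_class gamma u ->
  u x - u y <= gamma * (coord_sum x - coord_sum y) + (1 - gamma) * cost x y.
Proof.
move=> [[du _] ub]; have [z ->] := utility_mvt x y du.
rewrite /coord_sum /cost -sumrB !mulr_sumr -big_split/= ler_sum// => i _.
have /andP[] := ub z i; set D := 'D_ _ _ _; set t := x ord0 i - y ord0 i => gD D1.
rewrite -subr_ge0; have [t0|t0] := lerP t 0.
  have -> : gamma * t + (1 - gamma) * 0 - t * D = - t * (D - gamma) by ring.
  by rewrite mulr_ge0 ?subr_ge0 ?oppr_ge0.
have -> : gamma * t + (1 - gamma) * t - t * D = t * (1 - D) by ring.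
by rewrite mulr_ge0 ?(ltW t0) ?subr_ge0.
Qed.

Lemma cost_ge0 x y : 0 <= cost x y.
Proof. by apply: sumr_ge0 => i _; rewrite le_max lexx orbT. Qed.

Lemma norm1_ge0 x : 0 <= norm1 x.
Proof. exact: sumr_ge0. Qed.

Lemma cost_le_norm1 x y : cost x y <= norm1 (x - y).
Proof.
apply: ler_sum => i _; rewrite !mxE ge_max normr_ge0 andbT; exact: ler_norm.
Qed.

Lemma cost_triangle x y z : cost x z <= cost x y + cost y z.
Proof.
rewrite /cost -big_split/= ler_sum// => i _; rewrite ge_max.
have m (t : R) : 0 <= Num.max t 0 /\ t <= Num.max t 0.
  by rewrite !le_max !lexx orbT.
have [a1 a2] := m (x ord0 i - y ord0 i); have [b1 b2] := m (y ord0 i - z ord0 i).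
by apply/andP; split; lra.
Qed.

Lemma norm1B x y : norm1 (x - y) = norm1 (y - x).
Proof. by apply: eq_bigr => i _; rewrite !mxE distrC. Qed.

Lemma ler_norm1B x y : norm1 (x - y) <= norm1 x + norm1 y.
Proof.
by rewrite /norm1 -big_split/= ler_sum// => i _; rewrite !mxE ler_normB.
Qed.

(** In [utility_sub_le] the terms weighted by [gamma] and [1 - gamma] are both at most
    [norm1 (x - y)]. *)
Lemma utility_lipschitz gamma u x y : 0 <= gamma <= 1 -> utility_class gamma u ->
  `|u x - u y| <= norm1 (x - y).
Proof.
move=> /andP[g0 g1].
suff H z w : utility_class gamma u -> u z - u w <= norm1 (z - w).
  by move=> uu; rewrite ler_norml lerNl opprB H// norm1B H.
move=> uu; apply: le_trans (utility_sub_le z w uu) _.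
have sn : coord_sum z - coord_sum w <= norm1 (z - w).
  by rewrite /coord_sum -sumrB ler_sum// => i _; rewrite !mxE ler_norm.
have -> : norm1 (z - w) = gamma * norm1 (z - w) + (1 - gamma) * norm1 (z - w).
  by ring.
by rewrite lerD ?ler_wpM2l ?subr_ge0 ?cost_le_norm1.
Qed.

End utility.

(** Lets dominance at level [gamma] be tested against the larger class at level 0: a slope [s] in
    [0, 1] becomes [gamma + (1 - gamma) * s]. *)
Lemma utility_mix (R : realType) (d : nat) (gamma : R) (v : 'rV[R]_d -> R) :
  0 <= gamma <= 1 -> utility_class 0 v ->
  utility_class gamma (fun x => gamma * coord_sum x + (1 - gamma) * v x).
Proof.
move=> /andP[g0 g1] [[dv cv] pv].
have gv : has_grad v (fun i x => 'D_(delta_mx ord0 i) v x).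
  by move=> x; split => // i; split => //; exact: cv.
have gg : has_grad (@coord_sum R d) (fun _ _ => 1).
  apply: has_grad_eq (has_grad_sum (@has_grad_coord R d)) _ => i x /=.
  rewrite (bigD1 i)//= eqxx big1 ?addr0// => k.
  by rewrite eq_sym => /negPf ->.
have gu := has_gradD (has_gradZ gamma gg) (has_gradZ (1 - gamma) gv).
split; first exact: has_grad_C1 gu.
move=> x i; have [_ /(_ i)[-> _]] := gu x; rewrite mulr1.
have /andP[p0 p1] := pv x i.
have q : 0 <= 1 - gamma by rewrite subr_ge0.
rewrite lerDl mulr_ge0//= -[leRHS](subrKC gamma) lerD2l.
by rewrite -[leRHS]mulr1 ler_wpM2l.
Qed.

(** * Integrable random vectors *)

Section random_vectors.
Context {R : realType} {d : nat} {d1 : measure_display} {T : measurableType d1}.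
Context {P : probability T R}.
Implicit Types (X Y : {RV P >-> borel_rV R d}) (f : 'rV[R]_d -> R).

Lemma measurable_continuous_rV f : continuous f ->
  measurable_fun [set: borel_rV R d] (f : borel_rV R d -> R).
Proof.
move=> /continuousP cf.
apply: (measurability _ (RGenOpens.measurableE R)).
move=> _ [_ [a [b ->] <-]]; rewrite setTI; apply: sub_sigma_algebra.
exact/cf/interval_open.
Qed.

Lemma measurable_coord (i : 'I_d) :
  measurable_fun [set: borel_rV R d] (fun x : borel_rV R d => x ord0 i).
Proof. apply: measurable_continuous_rV; exact: coord_continuous. Qed.

Lemma measurable_norm1 : measurable_fun [set: borel_rV R d] (@norm1 R d).
Proof.
apply: measurable_sum => i; apply: measurableT_comp => //.
exact: measurable_coord.
Qed.

Lemma measurable_coord_sum : measurable_fun [set: borel_rV R d] (@coord_sum R d).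
Proof. by apply: measurable_sum => i; exact: measurable_coord. Qed.

(** Argued coordinatewise on the composite, so that joint measurability of [cost] on a product of
    Borel spaces does not arise. *)
Lemma measurable_cost X Y : measurable_fun setT (fun w => cost (X w) (Y w)).
Proof.
apply: measurable_sum => i; apply: measurable_maxr => //.
apply: measurable_funB.
  by apply: (measurableT_comp (measurable_coord i)).
by apply: (measurableT_comp (measurable_coord i)).
Qed.

(** The constant [k] absorbs the value of a Lipschitz function at 0. *)
Lemma integrable_le_norm1 X (k : R) (f : T -> R) :
  ('E_P[@norm1 R d \o X] < +oo)%E -> measurable_fun setT f ->
  (forall w, `|f w| <= norm1 (X w) + k) -> P.-integrable setT (EFin \o f).
Proof.
rewrite unlock => intX mf fX.
have iX : P.-integrable setT (EFin \o (@norm1 R d \o X)).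
  apply/integrableP; split.
    by apply/measurable_EFinP; exact: (measurableT_comp measurable_norm1).
  apply: le_lt_trans intX; apply: ge0_le_integral => //=.
  - do 2! apply: measurableT_comp => //.
    by exact: (measurableT_comp measurable_norm1).
  - by apply/measurable_EFinP; exact: (measurableT_comp measurable_norm1).
  - by move=> w _; rewrite lee_fin ger0_norm// norm1_ge0.
have ik : P.-integrable setT (cst k%:E) by exact: finite_measure_integrable_cst.
apply: le_integrable (integrableD _ iX ik) => //; first exact/measurable_EFinP.
by move=> w _ /=; rewrite lee_fin; apply: le_trans (fX w) _; exact: ler_norm.
Qed.

Lemma expectation_Rintegral (f : T -> R) : P.-integrable setT (EFin \o f) ->
  ('E_P[f] = (\int[P]_w f w)%:E)%E.
Proof. by move=> fi; rewrite unlock /Rintegral fineK// integrable_fin_num. Qed.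

Lemma integrable_norm1 X : ('E_P[@norm1 R d \o X] < +oo)%E ->
  P.-integrable setT (EFin \o (fun w => norm1 (X w))).
Proof.
move=> intX; apply: (@integrable_le_norm1 X 0) => //.
  exact: (measurableT_comp measurable_norm1).
by move=> w; rewrite addr0 ger0_norm// norm1_ge0.
Qed.

Lemma integrable_coord_sum X : ('E_P[@norm1 R d \o X] < +oo)%E ->
  P.-integrable setT (EFin \o (fun w => coord_sum (X w))).
Proof.
move=> intX; apply: (@integrable_le_norm1 X 0) => //.
  exact: (measurableT_comp measurable_coord_sum).
by move=> w; rewrite addr0; exact: ler_norm_sum.
Qed.

Lemma utility_measurable gamma u : utility_class gamma u ->
  measurable_fun [set: borel_rV R d] (u : borel_rV R d -> R).
Proof.
move=> [[du _] _]; apply: measurable_continuous_rV => x.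
exact: differentiable_continuous.
Qed.

Lemma integrable_utility gamma u X : 0 <= gamma <= 1 -> utility_class gamma u ->
  ('E_P[@norm1 R d \o X] < +oo)%E ->
  P.-integrable setT (EFin \o (fun w => u (X w))).
Proof.
move=> g01 uu intX; apply: (@integrable_le_norm1 X `|u 0|) => //.
  exact: (measurableT_comp (utility_measurable uu)).
move=> w; rewrite -[u (X w)](subrK (u 0)) (le_trans (ler_normD _ _))// lerD2r.
by have := utility_lipschitz (X w) 0 g01 uu; rewrite subr0.
Qed.

Lemma integrable_cost X Y : ('E_P[@norm1 R d \o X] < +oo)%E ->
  ('E_P[@norm1 R d \o Y] < +oo)%E ->
  P.-integrable setT (EFin \o (fun w => cost (X w) (Y w))).
Proof.
move=> /integrable_norm1 iX /integrable_norm1 iY.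
apply: le_integrable (integrableD _ iX iY) => //.
  by apply/measurable_EFinP; exact: measurable_cost.
move=> w _ /=; rewrite lee_fin ger0_norm ?cost_ge0//.
by rewrite (le_trans (cost_le_norm1 _ _))// (le_trans (ler_norm1B _ _)) ?ler_norm.
Qed.

End random_vectors.

(** * Integrals of random vectors with equal laws *)

Section law.
Context {R : realType} {d : nat} {d0 d1 : measure_display}.
Context {T0 : measurableType d0} {T1 : measurableType d1}.
Context {S : probability T0 R} {P : probability T1 R}.
Context (X' : {RV S >-> borel_rV R d}) (X : {RV P >-> borel_rV R d}).
Context (law : eq_in_law X' X).

Lemma ge0_integral_eq_in_law (f : borel_rV R d -> \bar R) :
  measurable_fun setT f -> (forall x, (0 <= f x)%E) ->
  (\int[S]_w f (X' w) = \int[P]_w f (X w))%E.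
Proof.
move=> mf f0; rewrite -(ge0_integral_distribution X' mf f0).
rewrite -(ge0_integral_distribution X mf f0).
by apply: eq_measure_integral => A mA _; exact: law.
Qed.

Lemma eq_in_law_norm1 : ('E_P[@norm1 R d \o X] < +oo)%E ->
  ('E_S[@norm1 R d \o X'] < +oo)%E.
Proof.
rewrite unlock (@ge0_integral_eq_in_law (fun x => (norm1 x)%:E)) => [//||x].
  by apply/measurable_EFinP; exact: measurable_norm1.
by rewrite lee_fin norm1_ge0.
Qed.

Lemma Rintegral_eq_in_law (f : borel_rV R d -> R) : measurable_fun setT f ->
  S.-integrable setT (EFin \o (fun w => f (X' w))) ->
  P.-integrable setT (EFin \o (fun w => f (X w))) ->
  \int[S]_w f (X' w) = \int[P]_w f (X w).
Proof.
move=> mf iX' iX; rewrite /Rintegral; congr fine.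
have /measurable_EFinP mEf := mf.
rewrite -(@integral_distribution _ _ _ _ _ S X' (EFin \o f) mEf iX').
rewrite -(@integral_distribution _ _ _ _ _ P X (EFin \o f) mEf iX).
by apply: eq_measure_integral => A mA _; exact: law.
Qed.

End law.

(** [utility_sub_le] integrated over one coupling. Only the cost term sees the joint law, so the
    other integrals move back to [P] and [Q]. *)
Lemma utility_coupling_le (R : realType) (d : nat) (d0 d1 d2 : measure_display)
    (T0 : measurableType d0) (T1 : measurableType d1) (T2 : measurableType d2)
    (S : probability T0 R) (P : probability T1 R) (Q : probability T2 R)
    (X' Y' : {RV S >-> borel_rV R d})
    (X : {RV P >-> borel_rV R d}) (Y : {RV Q >-> borel_rV R d}) gamma u :
  0 <= gamma <= 1 -> utility_class gamma u ->
  ('E_P[@norm1 R d \o X] < +oo)%E -> ('E_Q[@norm1 R d \o Y] < +oo)%E ->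
  eq_in_law X' X -> eq_in_law Y' Y ->
  \int[P]_w u (X w) - \int[Q]_w u (Y w) <=
  gamma * (\int[P]_w coord_sum (X w) - \int[Q]_w coord_sum (Y w)) +
  (1 - gamma) * \int[S]_w cost (X' w) (Y' w).
Proof.
move=> g01 uu intX intY lX lY.
have intX' := eq_in_law_norm1 lX intX; have intY' := eq_in_law_norm1 lY intY.
have mu := utility_measurable uu; have mg := @measurable_coord_sum R d.
have iuX' := integrable_utility g01 uu intX'.
have iuY' := integrable_utility g01 uu intY'.
have igX' := integrable_coord_sum intX'; have igY' := integrable_coord_sum intY'.
rewrite -(Rintegral_eq_in_law lX mu iuX' (integrable_utility g01 uu intX)).
rewrite -(Rintegral_eq_in_law lY mu iuY' (integrable_utility g01 uu intY)).
rewrite -(Rintegral_eq_in_law lX mg igX' (integrable_coord_sum intX)).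
rewrite -(Rintegral_eq_in_law lY mg igY' (integrable_coord_sum intY)).
have iD := integrableB measurableT igX' igY'.
have iC := integrable_cost intX' intY'.
have iD' := integrableZl measurableT gamma iD.
have iC' := integrableZl measurableT (1 - gamma) iC.
rewrite -!RintegralB// -!RintegralZl// -RintegralD//.
apply: le_Rintegral => //.
- exact: (integrableB measurableT iuX' iuY').
- exact: (integrableD measurableT iD' iC').
by move=> w _; exact: utility_sub_le.
Qed.

(** * Discretization and couplings *)

Section cells.
Context {R : realType} {d1 : measure_display} {T : measurableType d1}.
Context {P : probability T R} {A : finType} {kappa : T -> A}.
Context (mcell : forall a, measurable (kappa @^-1` [set a])).

(** A finite partition is encoded by the fibres of [kappa]. As [A] has no sigma-algebra, the
    composite is considered; its preimages are finite unions of cells. *)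
Lemma measurable_cells {d2 : measure_display} {U : measurableType d2}
    (f : A -> U) : measurable_fun setT (f \o kappa).
Proof.
move=> _ B mB; rewrite setTI.
have -> : (f \o kappa) @^-1` B =
    \bigcup_(a in f @^-1` B) kappa @^-1` [set a].
  apply/seteqP; split => [w fB|w [a fB e]]; first by exists (kappa w).
  by move: fB; rewrite /= -e.
exact: fin_bigcup_measurable.
Qed.

Lemma sum_indic_cells (f : A -> R) (w : T) :
  f (kappa w) = \sum_a f a * \1_(kappa @^-1` [set a]) w.
Proof.
rewrite (bigD1 (kappa w))//= indicE mem_set// mulr1 big1 ?addr0// => a aw.
rewrite indicE memNset ?mulr0//= => e.
by move: aw; rewrite e eqxx.
Qed.

Lemma Rintegral_cells (f : A -> R) :
  P.-integrable setT (EFin \o (f \o kappa)) /\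
  \int[P]_w f (kappa w) = \sum_a f a * fine (P (kappa @^-1` [set a])).
Proof.
have i1 a : P.-integrable setT (EFin \o \1_(kappa @^-1` [set a])).
  by apply: integrable_indic => //; rewrite setTI.
have i2 a : P.-integrable setT
    (fun w => (f a * \1_(kappa @^-1` [set a]) w)%:E).
  by have := integrableZl measurableT (f a) (i1 a).
have e w : (f (kappa w))%:E =
    (\sum_a (f a * \1_(kappa @^-1` [set a]) w)%:E)%E.
  by rewrite sumEFin -sum_indic_cells.
split.
  rewrite (_ : EFin \o _ = fun w => (\sum_a (f a *
    \1_(kappa @^-1` [set a]) w)%:E)%E); last by apply/funext => w; exact: e.
  exact: integrable_sum.
rewrite /Rintegral; under eq_integral do rewrite e.
rewrite integral_sum// -sum_fine => [|a _]; last exact: integrable_fin_num.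
apply: eq_bigr => a _; under eq_integral do rewrite EFinM.
rewrite integralZl//; last exact: i1.
by rewrite integral_indic// setIT fineM// fin_num_measure.
Qed.

Lemma measure_cells (B : set T) : measurable B ->
  P B = (\sum_a P (B `&` kappa @^-1` [set a]))%E.
Proof.
move=> mB; rewrite (fsbig_seq _ _ (index_enum_uniq A)).
rewrite -measure_fin_bigcup//; last by move=> a _; exact: measurableI.
  congr (P _); apply/seteqP; split => [w Bw|w [a _ []]//].
  by exists (kappa w) => //=; rewrite mem_index_enum.
apply/trivIsetP => a b _ _ ab; apply/seteqP; split => // w [[_ ea] [_ eb]].
by move: ab; rewrite -ea -eb eqxx.
Qed.

End cells.

(** Each coordinate is approximated in L^1 by a simple function, and the joint values of these
    functions label the cells. *)
Lemma discretization (R : realType) (d : nat) (d1 : measure_display)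
    (T : measurableType d1) (P : probability T R) (X : {RV P >-> borel_rV R d})
    (eps : R) :
  ('E_P[@norm1 R d \o X] < +oo)%E -> 0 < eps ->
  exists (A : finType) (kappa : T -> A) (x : A -> 'rV[R]_d),
    [/\ forall a, measurable (kappa @^-1` [set a]) &
      (\int[P]_w (norm1 (X w - x (kappa w)))%:E <= eps%:E)%E].
Proof.
(* The denominator [d + 1] is never 0, and [d] errors of size [e] still sum to at most [eps]. *)
move=> intX eps0; pose e := eps / d.+1%:R.
have e0 : 0 < e by rewrite divr_gt0.
have iXi (i : 'I_d) : P.-integrable setT (EFin \o (fun w => X w ord0 i)).
  apply: (@integrable_le_norm1 R d _ _ _ X 0) => //.
    exact: (measurableT_comp (measurable_coord i)).
  by move=> w; rewrite addr0 /norm1 (bigD1 i)//= lerDl sumr_ge0.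
have ex_s (i : 'I_d) : exists s : {sfun T >-> R},
    (\int[P]_w (`|X w ord0 i - s w|)%:E <= e%:E)%E.
  have [g [_ _ cg]] := approximation_sfun_integrable measurableT (iXi i).
  have /fine_cvgP[fg /cvgrPdist_lt/(_ e e0) lg] := cg.
  have [N _ /(_ N (leqnn N))[fN]] := filterI fg lg.
  rewrite sub0r normrN => /ltW lN; exists (g N).
  have -> : (\int[P]_w (`|X w ord0 i - g N w|)%:E = \int[P]_(z in setT)
      `|(EFin \o (fun w => X w ord0 i)) z - (g N z)%:E|)%E by [].
  rewrite -(fineK fN) lee_fin; apply: le_trans lN; exact: ler_norm.
have [s hs] := choice ex_s.
have ex_r (i : 'I_d) : exists r : seq R, forall w, s i w \in r.
  have /finite_seqP[r er] : finite_set (range (s i)) by exact: fimfunP.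
  exists r => w; have : range (s i) (s i w) by exists w.
  by rewrite er.
have [r hr] := choice ex_r.
(* [L] collects the values of all coordinates. The label type has one more element than [L] has
   entries, as [inord] needs a nonempty ordinal type; the extra label is read as 0. *)
pose L := flatten [seq r i | i <- enum 'I_d].
have sL i w : s i w \in L.
  by apply/flatten_mapP; exists i; rewrite ?mem_enum.
pose A : finType := {ffun 'I_d -> 'I_(size L).+1}.
pose kappa w : A := [ffun i => inord (index (s i w) L)].
pose x (a : A) : 'rV[R]_d := \row_i nth 0 L (a i).
have xk w : x (kappa w) = \row_i s i w.
  apply/rowP => i; rewrite !mxE ffunE inordK ?nth_index//.
  by rewrite ltnS index_size.
exists A, kappa, x; split => [a|].
  (* Intersecting with the finite range of [s i] turns the label condition into a finite, hence
     measurable, set of reals. *)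
  have -> : kappa @^-1` [set a] = \bigcap_(i in [set: 'I_d])
      s i @^-1` ([set t | inord (index t L) = a i] `&` range (s i)).
    apply/seteqP; split => [w /= <- i _|w /= h].
      by split; [rewrite /= ffunE|exists w].
    by apply/ffunP => i; rewrite ffunE; have [] := h i I.
  apply: fin_bigcap_measurable => // i _; apply: measurable_funPTI => //.
  apply: countable_measurable => [t|]; first exact: measurable_set1.
  by apply: finite_set_countable; apply: finite_setIr; exact: fimfunP.
under eq_integral do rewrite xk /norm1 -sumEFin.
have mXs (i : 'I_d) :
    measurable_fun setT (fun w => (`|(X w - \row_j s j w) ord0 i|)%:E).
  apply/measurable_EFinP; apply: measurableT_comp => //.
  under eq_fun do rewrite !mxE.
  apply: measurable_funB => //.
  exact: (measurableT_comp (measurable_coord i)).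
rewrite ge0_integral_sum//.
apply: (@le_trans _ _ (\sum_(i < d) e%:E)%E).
  apply: lee_sum => i _; apply: le_trans (hs i).
  by under eq_integral do rewrite !mxE.
rewrite sumEFin lee_fin sumr_const card_ord -[leLHS]mulr_natr /e mulrAC.
by rewrite ler_pdivrMr// ler_pM2l// ler_nat.
Qed.

(** The product measure is multiplied on each product of cells by [pi a b] over the product of the
    two cell masses. Summing over [b], the row sum of [pi] cancels the mass of cell [a] and leaves
    [P] there; columns behave likewise. *)
Lemma plan_coupling (R : realType) (d1 d2 : measure_display)
    (T1 : measurableType d1) (T2 : measurableType d2)
    (P : probability T1 R) (Q : probability T2 R) (A B : finType)
    (ka : T1 -> A) (kb : T2 -> B) (pi : A -> B -> R) :
  (forall a, measurable (ka @^-1` [set a])) ->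
  (forall b, measurable (kb @^-1` [set b])) ->
  (forall a b, 0 <= pi a b) ->
  (forall a, \sum_b pi a b = fine (P (ka @^-1` [set a]))) ->
  (forall b, \sum_a pi a b = fine (Q (kb @^-1` [set b]))) ->
  exists S : probability (T1 * T2)%type R,
    [/\ forall E, measurable E -> S (fst @^-1` E) = P E,
        forall E, measurable E -> S (snd @^-1` E) = Q E &
        forall a b, S ((ka @^-1` [set a]) `*` (kb @^-1` [set b])) = (pi a b)%:E].
Proof.
move=> mka mkb pi0 piP piQ.
pose p a := fine (P (ka @^-1` [set a])).
pose q b := fine (Q (kb @^-1` [set b])).
have mcell ab : measurable ((ka @^-1` [set ab.1]) `*` (kb @^-1` [set ab.2])).
  exact: measurableX.
have w0 (ab : A * B) : 0 <= pi ab.1 ab.2 / (p ab.1 * q ab.2).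
  by rewrite divr_ge0// mulr_ge0// fine_ge0.
(* A space carrying a probability is inhabited. [w1] and [w2] supply the default of the [nth]
   through which [msum], indexed by naturals, runs over pairs of cells. *)
have [w1 _] : [set: T1] !=set0.
  apply/set0P/eqP => T0; have := probability_setT P.
  by rewrite T0 measure0 => /eqP; rewrite eq_sym onee_eq0.
have [w2 _] : [set: T2] !=set0.
  apply/set0P/eqP => T0; have := probability_setT Q.
  by rewrite T0 measure0 => /eqP; rewrite eq_sym onee_eq0.
(* The coefficients use [x / 0 = 0], which is harmless because [pi] vanishes
   on null cells. *)
pose cell k := nth (ka w1, kb w2) (index_enum (A * B)%type) k.
pose m := msum (fun k => mscale (NngNum (w0 (cell k)))
  (mrestr (P \x Q)%E (mcell (cell k))))
  (size (index_enum (A * B)%type)).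
have mE E : m E = (\sum_(ab : A * B) (pi ab.1 ab.2 / (p ab.1 * q ab.2))%:E *
    (P \x Q) (E `&` (ka @^-1` [set ab.1]) `*` (kb @^-1` [set ab.2])))%E.
  by rewrite /m /msum (big_nth (ka w1, kb w2)) big_mkord.
have mX E F : measurable E -> measurable F -> m (E `*` F) =
    (\sum_a \sum_b pi a b / (p a * q b) *
      (fine (P (E `&` ka @^-1` [set a])) * fine (Q (F `&` kb @^-1` [set b]))))%:E.
  move=> mE' mF; rewrite mE pair_bigA -sumEFin; apply: eq_bigr => -[a b] _ /=.
  rewrite -setXI product_measure1E; [|exact: measurableI..].
  rewrite [RHS]EFinM; congr (_ * _)%E.
  by rewrite EFinM !fineK// fin_num_measure//; exact: measurableI.
have pi_p a b : p a = 0 -> pi a b = 0.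
  rewrite /p -piP => pa.
  by apply: (psumr_eq0P _ pa) => // b' _; exact: pi0.
have pi_q a b : q b = 0 -> pi a b = 0.
  rewrite /q -piQ => qb.
  by apply: (psumr_eq0P _ qb) => // a' _; exact: pi0.
have m1 E : measurable E -> m (fst @^-1` E) = P E.
  move=> mE'; have -> : fst @^-1` E = E `*` [set: T2].
    by apply/seteqP; split => [w|w []].
  rewrite mX// (measure_cells (P := P) mka mE') -sumEFin.
  apply: eq_bigr => a _; rewrite -[RHS]fineK; last first.
    by rewrite fin_num_measure//; exact: measurableI.
  congr (_%:E); set Pa := fine (P (E `&` _)).
  (* On a null cell both sides vanish, the right one by monotonicity of [P]; elsewhere [p a]
     cancels. *)
  have [pa|pa] := eqVneq (p a) 0.
    rewrite big1 => [|b _]; last by rewrite pi_p// !mul0r.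
    apply/esym/eqP; rewrite eq_le fine_ge0// andbT -[leRHS]pa fine_le//.
    - by rewrite fin_num_measure//; exact: measurableI.
    - by rewrite fin_num_measure.
    - by rewrite le_measure ?inE//; exact: measurableI.
  rewrite -[RHS](mulfVK pa) -[X in _ = _ * X]piP mulr_sumr.
  apply: eq_bigr => b _; rewrite setTI -/(q b).
  have [qb|qb] := eqVneq (q b) 0; first by rewrite pi_q// !mul0r mulr0.
  by field; rewrite pa qb.
have m2 E : measurable E -> m (snd @^-1` E) = Q E.
  move=> mE'; have -> : snd @^-1` E = [set: T1] `*` E.
    by apply/seteqP; split => [w|w []].
  rewrite mX// exchange_big (measure_cells (P := Q) mkb mE') -sumEFin.
  apply: eq_bigr => b _; rewrite -[RHS]fineK; last first.
    by rewrite fin_num_measure//; exact: measurableI.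
  congr (_%:E); set Qb := fine (Q (E `&` _)).
  have [qb|qb] := eqVneq (q b) 0.
    rewrite big1 => [|a _]; last by rewrite pi_q// !mul0r.
    apply/esym/eqP; rewrite eq_le fine_ge0// andbT -[leRHS]qb fine_le//.
    - by rewrite fin_num_measure//; exact: measurableI.
    - by rewrite fin_num_measure.
    - by rewrite le_measure ?inE//; exact: measurableI.
  rewrite -[RHS](mulfVK qb) -[X in _ = _ * X]piQ mulr_sumr.
  apply: eq_bigr => a _; rewrite setTI -/(p a).
  have [pa|pa] := eqVneq (p a) 0; first by rewrite pi_p// !mul0r mulr0.
  by field; rewrite pa qb.
have mT : m setT = 1%E by rewrite -(preimage_setT fst) m1// probability_setT.
pose S : probability (T1 * T2)%type R :=
  HB.pack m (Measure_isProbability.Build _ _ _ m mT).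
exists S; split => // a b; rewrite [LHS]mX//; congr (_%:E).
rewrite (bigD1 a)//= [X in _ + X]big1 ?addr0 => [|a' aa']; last first.
  apply: big1 => b' _; rewrite (_ : _ `&` _ = set0) ?measure0 ?mul0r ?mulr0//.
  apply/seteqP; split => // w [/= e1 e2].
  by move: aa'; rewrite -e1 -e2 eqxx.
rewrite (bigD1 b)//= [X in _ + X]big1 ?addr0 => [|b' bb']; last first.
  rewrite [X in Q X](_ : _ = set0) ?measure0 ?mulr0//.
  apply/seteqP; split => // w [/= e1 e2].
  by move: bb'; rewrite -e1 -e2 eqxx.
rewrite !setIid -/(p a) -/(q b).
have [pa|pa] := eqVneq (p a) 0; first by rewrite pi_p// !mul0r.
have [qb|qb] := eqVneq (q b) 0; first by rewrite pi_q// !mul0r.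
by field; rewrite pa qb.
Qed.

Lemma measurable_norm1_cells (R : realType) (d : nat) (d1 : measure_display)
    (T : measurableType d1) (P : probability T R) (X : {RV P >-> borel_rV R d})
    (A : finType) (kappa : T -> A) (x : A -> 'rV[R]_d) :
  (forall a, measurable (kappa @^-1` [set a])) ->
  measurable_fun setT (fun w => norm1 (X w - x (kappa w))).
Proof.
move=> mk; apply: measurable_sum => i; apply: measurableT_comp => //.
under eq_fun do rewrite !mxE; apply: measurable_funB.
  exact: (measurableT_comp (measurable_coord i)).
exact: (measurable_cells mk (fun a => x a ord0 i)).
Qed.

Lemma ge0_integral_marginal (R : realType) (d0 d1 : measure_display)
    (T0 : measurableType d0) (T : measurableType d1)
    (S : probability T0 R) (P : probability T R)
    (phi : T0 -> T) (f : T -> \bar R) : measurable_fun setT phi ->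
  (forall E, measurable E -> S (phi @^-1` E) = P E) ->
  measurable_fun setT f -> (forall w, (0 <= f w)%E) ->
  (\int[S]_w f (phi w) = \int[P]_w f w)%E.
Proof.
move=> mphi SP mf f0.
have := @ge0_integral_pushforward _ _ _ _ R _ mphi S setT f measurableT mf.
rewrite preimage_setT => <- => [|y _]; last exact: f0.
by apply: eq_measure_integral => E mE _; exact: SP.
Qed.

Section transport_approximation.
Context {R : realType} {d : nat} {d1 d2 : measure_display}.
Context {T1 : measurableType d1} {T2 : measurableType d2}.
Context {P : probability T1 R} {Q : probability T2 R}.
Context {X : {RV P >-> borel_rV R d}} {Y : {RV Q >-> borel_rV R d}}.

(** Under the coupling built from the plan, the triangle inequality goes from [X] through [x] and
    [y] to [Y]. The outer terms depend on one marginal each, and the middle one is constant on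
    products of cells. *)
Lemma OT_le_plan (A B : finType) (ka : T1 -> A) (kb : T2 -> B)
    (x : A -> 'rV[R]_d) (y : B -> 'rV[R]_d) (pi : A -> B -> R) (ex ey : R) :
  (forall a, measurable (ka @^-1` [set a])) ->
  (forall b, measurable (kb @^-1` [set b])) ->
  (forall a b, 0 <= pi a b) ->
  (forall a, \sum_b pi a b = fine (P (ka @^-1` [set a]))) ->
  (forall b, \sum_a pi a b = fine (Q (kb @^-1` [set b]))) ->
  (\int[P]_w (norm1 (X w - x (ka w)))%:E <= ex%:E)%E ->
  (\int[Q]_w (norm1 (Y w - y (kb w)))%:E <= ey%:E)%E ->
  (OT cost X Y <= (ex + \sum_a \sum_b cost (x a) (y b) * pi a b + ey)%:E)%E.
Proof.
move=> mka mkb pi0 piP piQ hx hy.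
have [S [S1 S2 Spi]] := plan_coupling mka mkb pi0 piP piQ.
have mX' : measurable_fun [set: T1 * T2] (X \o fst).
  by apply: measurableT_comp => //; exact: measurable_fst.
have mY' : measurable_fun [set: T1 * T2] (Y \o snd).
  by apply: measurableT_comp => //; exact: measurable_snd.
pose X' : {RV S >-> borel_rV R d} :=
  HB.pack (X \o fst) (isMeasurableFun.Build _ _ _ _ _ mX').
pose Y' : {RV S >-> borel_rV R d} :=
  HB.pack (Y \o snd) (isMeasurableFun.Build _ _ _ _ _ mY').
have lX : eq_in_law X' X.
  by move=> E mE; apply: (S1 (X @^-1` E)); exact: measurable_funPTI.
have lY : eq_in_law Y' Y.
  by move=> E mE; apply: (S2 (Y @^-1` E)); exact: measurable_funPTI.
apply: (@le_trans _ _ 'E_S[fun w => cost (X' w) (Y' w)]%E).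
  by apply: ereal_inf_lbound; exists _, _, S, X', Y'.
rewrite unlock.
pose kappa (w : T1 * T2) := (ka w.1, kb w.2).
have kE ab : kappa @^-1` [set ab] =
    (ka @^-1` [set ab.1]) `*` (kb @^-1` [set ab.2]).
  by case: ab => a b; apply/seteqP; split => [w [<- <-]//|w /= [<- <-]].
have mk ab : measurable (kappa @^-1` [set ab]).
  by rewrite kE; exact: measurableX.
pose f1 w := (norm1 (X w - x (ka w)))%:E.
pose f2 w := (norm1 (Y w - y (kb w)))%:E.
pose f3 (ab : A * B) := cost (x ab.1) (y ab.2).
have mf1 : measurable_fun setT f1.
  by apply/measurable_EFinP; exact: measurable_norm1_cells.
have mf2 : measurable_fun setT f2.
  by apply/measurable_EFinP; exact: measurable_norm1_cells.
have f10 w : (0 <= f1 w)%E by rewrite lee_fin norm1_ge0.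
have f20 w : (0 <= f2 w)%E by rewrite lee_fin norm1_ge0.
have mf1' : measurable_fun setT (fun w : T1 * T2 => f1 w.1).
  by apply: measurableT_comp => //; exact: measurable_fst.
have mf2' : measurable_fun setT (fun w : T1 * T2 => f2 w.2).
  by apply: measurableT_comp => //; exact: measurable_snd.
have mf3 : measurable_fun setT (fun w => (f3 (kappa w))%:E).
  by apply/measurable_EFinP; exact: (measurable_cells mk f3).
have f30 w : (0 <= (f3 (kappa w))%:E)%E by rewrite lee_fin cost_ge0.
apply: (@le_trans _ _
    (\int[S]_w (f1 w.1 + (f3 (kappa w))%:E + f2 w.2))%E).
  apply: ge0_le_integral => //.
  - by move=> w _; rewrite lee_fin cost_ge0.
  - by apply/measurable_EFinP; exact: measurable_cost.
  - by apply: emeasurable_funD => //; exact: emeasurable_funD.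
  move=> [w1 w2] _; rewrite lee_fin /=.
  apply: le_trans (cost_triangle _ (y (kb w2)) _) _; apply: lerD.
    apply: le_trans (cost_triangle _ (x (ka w1)) _) _; apply: lerD => //.
    exact: cost_le_norm1.
  by rewrite norm1B; exact: cost_le_norm1.
rewrite ge0_integralD//; last 2 first.
- by move=> w _; rewrite adde_ge0.
- exact: emeasurable_funD.
rewrite ge0_integralD//.
rewrite (ge0_integral_marginal (phi := fst) measurable_fst S1)//.
rewrite (ge0_integral_marginal (phi := snd) measurable_snd S2)//.
rewrite !EFinD; apply: leeD => //; apply: leeD => //.
have [i3 e3] := Rintegral_cells (P := S) mk f3.
rewrite -[leLHS]fineK; last exact: integrable_fin_num.
rewrite lee_fin [leLHS]e3 pair_bigA le_eqVlt; apply/orP; left; apply/eqP.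
by apply: eq_bigr => ab _; rewrite kE Spi.
Qed.

End transport_approximation.

(** * Approximate duality *)

Lemma Rintegral_prob_cst (R : realType) (d1 : measure_display)
    (T : measurableType d1) (P : probability T R) (r : R) : \int[P]_w r = r.
Proof.
rewrite Rintegral_cst// -[RHS]mulr1; congr (_ * _).
exact: (congr1 fine (probability_setT P)).
Qed.

Lemma sum_cells (R : realType) (d1 : measure_display) (T : measurableType d1)
    (P : probability T R) (A : finType) (kappa : T -> A) :
  (forall a, measurable (kappa @^-1` [set a])) ->
  \sum_a fine (P (kappa @^-1` [set a])) = 1.
Proof.
move=> mk; have [_ e] := Rintegral_cells (P := P) mk (fun=> 1).
under eq_bigr do rewrite -[fine _]mul1r.
by rewrite -e Rintegral_prob_cst.
Qed.

Lemma integrable_norm1_cells (R : realType) (d : nat) (d1 : measure_display)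
    (T : measurableType d1) (P : probability T R) (X : {RV P >-> borel_rV R d})
    (A : finType) (kappa : T -> A) (x : A -> 'rV[R]_d) (e : R) :
  (forall a, measurable (kappa @^-1` [set a])) ->
  (\int[P]_w (norm1 (X w - x (kappa w)))%:E <= e%:E)%E ->
  P.-integrable setT (EFin \o (fun w => norm1 (X w - x (kappa w)))) /\
  \int[P]_w norm1 (X w - x (kappa w)) <= e.
Proof.
move=> mk he; have iN : P.-integrable setT
    (EFin \o (fun w => norm1 (X w - x (kappa w)))).
  apply/integrableP; split.
    by apply/measurable_EFinP; exact: measurable_norm1_cells.
  apply: le_lt_trans (ltry e); apply: le_trans he.
  rewrite le_eqVlt; apply/orP; left; apply/eqP; apply: eq_integral => w _ /=.
  by rewrite ger0_norm// norm1_ge0.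
split=> //; rewrite -lee_fin /Rintegral fineK//; exact: integrable_fin_num.
Qed.

Section approximate_duality.
Context {R : realType} {d : nat} {d1 d2 : measure_display}.
Context {T1 : measurableType d1} {T2 : measurableType d2}.
Context {P : probability T1 R} {Q : probability T2 R}.
Context {X : {RV P >-> borel_rV R d}} {Y : {RV Q >-> borel_rV R d}}.
Context (intX : ('E_P[@norm1 R d \o X] < +oo)%E)
  (intY : ('E_Q[@norm1 R d \o Y] < +oo)%E).

(** Approximate strong duality at one level [t], from the alternative in [transport_duality] for the
    discretized laws: a plan lifts to a coupling, and potentials are smoothed to a utility. *)
Lemma OT_dichotomy (t eps : R) : 0 < eps ->
  (OT cost X Y <= (t + eps)%:E)%E \/
  exists2 u, utility_class 0 u &
    t - eps < \int[P]_w u (X w) - \int[Q]_w u (Y w).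
Proof.
(* A plan loses [e] per discretization; potentials lose this and another [e] per side for smoothing,
   in total [4 * e]. *)
move=> eps0; pose e := eps / 4.
have e0 : 0 < e by rewrite divr_gt0.
have [A [ka [x [mka hx]]]] := discretization intX e0.
have [B [kb [y [mkb hy]]]] := discretization intY e0.
have [||||[pi [pi0 piP piQ pit]]|[phi [psi [phipsi tphipsi]]]] :=
  @transport_duality R A B (fun a => fine (P (ka @^-1` [set a])))
    (fun b => fine (Q (kb @^-1` [set b]))) (fun a b => cost (x a) (y b)) t.
- by move=> a; rewrite fine_ge0.
- by move=> b; rewrite fine_ge0.
- exact: sum_cells.
- exact: sum_cells.
- left; apply: le_trans (OT_le_plan mka mkb pi0 piP piQ hx hy) _.
  rewrite lee_fin; have : eps = 4 * e by rewrite mulrC divfK.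
  lra.
right; have B0 : (0 < #|B|)%N.
  rewrite lt0n; apply/eqP => B0; have := sum_cells Q mkb.
  rewrite big1 => [/esym/eqP|b _]; first by rewrite oner_eq0.
  by have := fintype0 b B0.
have [u [uu uphi upsi]] := smooth_potential e0 B0 phipsi.
have g01 : 0 <= (0 : R) <= 1 by rewrite lexx ler01.
exists u => //.
have [iN hN] := integrable_norm1_cells mka hx.
have [iM hM] := integrable_norm1_cells mkb hy.
have [iphi ephi] := Rintegral_cells (P := P) mka phi.
have [ipsi epsi] := Rintegral_cells (P := Q) mkb psi.
have iuX := integrable_utility g01 uu intX.
have iuY := integrable_utility g01 uu intY.
have ieP : P.-integrable setT (EFin \o (fun=> e)).
  exact: finite_measure_integrable_cst.
have ieQ : Q.-integrable setT (EFin \o (fun=> e)).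
  exact: finite_measure_integrable_cst.
(* Lipschitz continuity replaces [X] by its discretized value, where [u] is at least [phi - e]. *)
have HX : \int[P]_w phi (ka w) <=
    \int[P]_w u (X w) + \int[P]_w norm1 (X w - x (ka w)) + e.
  have -> : e = \int[P]_w e by rewrite Rintegral_prob_cst.
  have i1 := integrableD measurableT iuX iN.
  rewrite -RintegralD// -RintegralD//.
  apply: le_Rintegral => //; first exact: (integrableD measurableT i1 ieP).
  move=> w _; have := uphi (ka w).
  have := utility_lipschitz (X w) (x (ka w)) g01 uu.
  by rewrite ler_norml => /andP[]; lra.
have HY : \int[Q]_w u (Y w) + \int[Q]_w psi (kb w) <=
    \int[Q]_w norm1 (Y w - y (kb w)) + e.
  have -> : e = \int[Q]_w e by rewrite Rintegral_prob_cst.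
  rewrite -RintegralD// -RintegralD//.
  apply: le_Rintegral => //.
  - exact: (integrableD measurableT iuY ipsi).
  - exact: (integrableD measurableT iM ieQ).
  move=> w _; have := upsi (kb w).
  have := utility_lipschitz (Y w) (y (kb w)) g01 uu.
  by rewrite ler_norml => /andP[]; lra.
move: HX HY; rewrite ephi epsi.
under eq_bigr do rewrite mulrC.
under [X in _ + X <= _ -> _]eq_bigr do rewrite mulrC.
have : eps = 4 * e by rewrite mulrC divfK.
by move: tphipsi hN hM; lra.
Qed.

Lemma OT_ge0 : (0 <= OT cost X Y)%E.
Proof.
apply: le_ereal_inf_tmp => _ [d0 [T [S [X' [Y' [_ _ ->]]]]]].
by apply: expectation_ge0 => w; exact: cost_ge0.
Qed.

(** With one cell per space and value 0, [OT_le_plan] uses the product coupling and bounds the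
    transport cost by the sum of the two first moments. *)
Lemma OT_fin_num : OT cost X Y \is a fin_num.
Proof.
have ttT d' (T : measurableType d') (a : unit) :
    (fun _ : T => tt) @^-1` [set a] = setT.
  by case: a; apply/seteqP; split.
have mtt d' (T : measurableType d') (a : unit) :
    measurable ((fun _ : T => tt) @^-1` [set a]) by rewrite ttT.
have ptt d' (T : measurableType d') (S : probability T R) (a : unit) :
    \sum_(b : unit) 1 = fine (S ((fun _ : T => tt) @^-1` [set a])).
  rewrite ttT sumr_const card_unit; apply/esym.
  exact: (congr1 fine (probability_setT S)).
have ntt d' (T : measurableType d') (S : probability T R)
    (Z : {RV S >-> borel_rV R d}) : ('E_S[@norm1 R d \o Z] < +oo)%E ->
    (\int[S]_w (norm1 (Z w - 0))%:E <= (\int[S]_w norm1 (Z w))%:E)%E.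
  move=> intZ; under eq_integral do rewrite subr0.
  rewrite /Rintegral fineK//.
  exact: integrable_fin_num (integrable_norm1 intZ).
have := OT_le_plan (x := fun=> 0) (y := fun=> 0)
  (mtt _ T1) (mtt _ T2) (fun _ _ => ler01)
  (ptt _ _ P) (ptt _ _ Q) (ntt _ _ _ _ intX) (ntt _ _ _ _ intY).
by rewrite ge0_fin_numE ?OT_ge0// => /le_lt_trans; apply; exact: ltry.
Qed.

(** Weak duality: the bound for a single coupling passes to the infimum. *)
Lemma OT_utility_le gamma u : 0 <= gamma <= 1 -> utility_class gamma u ->
  \int[P]_w u (X w) - \int[Q]_w u (Y w) <=
  gamma * (\int[P]_w coord_sum (X w) - \int[Q]_w coord_sum (Y w)) +
  (1 - gamma) * fine (OT cost X Y).
Proof.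
move=> g01 uu; rewrite -lerBlDl; set a := _ - gamma * _.
have H e : coupling_costs cost X Y e ->
    exists2 r, e = r%:E & a <= (1 - gamma) * r.
  move=> [d0 [T [S [X' [Y' [lX lY ->]]]]]].
  exists (\int[S]_w cost (X' w) (Y' w)).
    rewrite expectation_Rintegral//; apply: integrable_cost.
      exact: eq_in_law_norm1 lX intX.
    exact: eq_in_law_norm1 lY intY.
  by rewrite /a lerBlDl; exact: utility_coupling_le.
(* Division by [1 - gamma] is impossible here, but the cost term vanishes and any coupling will do;
   one exists since the infimum is finite. *)
have [g1|g1] := eqVneq gamma 1.
  have /ereal_inf_lt[e Ce _] : (OT cost X Y < +oo)%E.
    by rewrite ltey_eq OT_fin_num.
  by have [r _] := H e Ce; rewrite g1 subrr !mul0r.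
have g0 : 0 < 1 - gamma by rewrite subr_gt0 lt_neqAle g1; case/andP: g01.
rewrite -ler_pdivrMl// -lee_fin fineK ?OT_fin_num//.
apply: le_ereal_inf_tmp => e /H[r -> ar].
by rewrite lee_fin ler_pdivrMl.
Qed.

(** A positive denominator is cleared. If it is 0, the mean difference and the transport cost, both
    nonnegative, vanish, and 0/0 = 0 makes both inequalities true. *)
Lemma gamma_star_le gamma : 0 <= gamma <= 1 ->
  ('E_P[@coord_sum R d \o X] <= 'E_Q[@coord_sum R d \o Y])%E ->
  gamma_star cost coord_sum X Y <= gamma <->
  (1 - gamma) * fine (OT cost X Y) <=
    gamma * (\int[Q]_w coord_sum (Y w) - \int[P]_w coord_sum (X w)).
Proof.
move=> g01; have iX := integrable_coord_sum intX.
have iY := integrable_coord_sum intY.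
rewrite /gamma_star !expectation_Rintegral// lee_fin/=.
set m := \int[Q]_w _ => m0; set m' := \int[P]_w _ in m0 *.
have T0 : 0 <= fine (OT cost X Y) by rewrite fine_ge0// OT_ge0.
set T := fine _ in T0 *.
have : 0 <= m - m' + T by rewrite addr_ge0// subr_ge0.
rewrite le_eqVlt => /predU1P[e|p].
  have T_0 : T = 0 by move: m0; lra.
  have -> : m - m' = 0 by move: m0; lra.
  by case/andP: g01 => g0 _; rewrite T_0 !mul0r !mulr0 g0 lexx.
rewrite ler_pdivrMr//; split; lra.
Qed.

End approximate_duality.

Theorem theorem3p8 (R : realType) (d : nat) (d_ge1 : (1 <= d)%N)
    (gamma : R) (gamma01 : 0 <= gamma <= 1)
    (d1 d2 : measure_display)
    (T1 : measurableType d1) (T2 : measurableType d2)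
    (P : probability T1 R) (Q : probability T2 R)
    (X : {RV P >-> borel_rV R d}) (Y : {RV Q >-> borel_rV R d})
    (intX : ('E_P[norm1 \o X] < +oo)%E) (intY : ('E_Q[norm1 \o Y] < +oo)%E)
    (mean_le : ('E_P[coord_sum \o X] <= 'E_Q[coord_sum \o Y])%E) :
  gamma_star cost coord_sum X Y <= gamma <-> almost_dominated gamma X Y.
Proof.
rewrite gamma_star_le//.
set m := \int[Q]_w _ - _; set T := fine _; split => [Tm u uu|dom].
  have iX := integrable_utility gamma01 uu intX.
  have iY := integrable_utility gamma01 uu intY.
  rewrite !expectation_Rintegral// lee_fin -subr_le0.
  apply: le_trans (OT_utility_le intX intY gamma01 uu) _.
  by rewrite -/T -(opprB (\int[Q]_w _)) -/m mulrN addrC subr_le0.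
have m0 : 0 <= m.
  rewrite subr_ge0; move: mean_le; rewrite !expectation_Rintegral ?lee_fin//.
    exact: integrable_coord_sum.
  exact: integrable_coord_sum.
(* For [gamma = 1] the claim reduces to [0 <= m]. *)
case/andP: (gamma01) => g0; rewrite le_eqVlt => /predU1P[g1|g1].
  by rewrite g1 subrr mul0r mul1r.
have g1' : 0 < 1 - gamma by rewrite subr_gt0.
rewrite -ler_pdivlMl//; apply/ler_addgt0Pr => eps eps0.
rewrite -lee_fin fineK ?OT_fin_num//.
have e0 : 0 < eps / 2 by rewrite divr_gt0.
set t0 := _^-1 * _.
(* At level [t0 + eps / 2] with tolerance [eps / 2], the first alternative is the goal, and the
   second makes the gap of [v] exceed [t0] itself. *)
have [H|[v uv]] := OT_dichotomy intX intY (t0 + eps / 2) e0.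
  by rewrite -addrA -splitr in H.
rewrite addrK => tv.
(* Dominance for the mixture bounds [1 - gamma] times the gap of [v] by [gamma * m], which is
   [(1 - gamma) * t0]: a contradiction. *)
have := dom _ (utility_mix gamma01 uv).
have g01 : 0 <= (0 : R) <= 1 by rewrite lexx ler01.
have ivX := integrable_utility g01 uv intX.
have ivY := integrable_utility g01 uv intY.
have igX := integrable_coord_sum intX; have igY := integrable_coord_sum intY.
have igX' := integrableZl measurableT gamma igX.
have igY' := integrableZl measurableT gamma igY.
have ivX' := integrableZl measurableT (1 - gamma) ivX.
have ivY' := integrableZl measurableT (1 - gamma) ivY.
rewrite !expectation_Rintegral; last 2 first.
- exact: (integrableD measurableT igY' ivY').
- exact: (integrableD measurableT igX' ivX').
rewrite lee_fin !RintegralD// !RintegralZl// => H.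
suff : (1 - gamma) * t0 < gamma * m.
  by rewrite /t0 mulrA divff ?gt_eqF// mul1r ltxx.
apply: (@lt_le_trans _ _
  ((1 - gamma) * (\int[P]_w v (X w) - \int[Q]_w v (Y w)))).
  by rewrite ltr_pM2l.
by move: H; rewrite /m !mulrBr; lra.
Qed.
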